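(* As $p\to\infty$ through primes, we have $$M(p)\le p^{3/2+o(1)}.$$
   Context: An integer $n$ is $y$-smooth if all prime divisors of $n$ do not exceed $y$; it is square-free if it is not divisible by the square of a prime. For a prime $p$, $M(p)$ denotes the smallest integer $M$ such that every residue class modulo $p$ (including the class of $0$) contains a positive $p$-smooth square-free representative not exceeding $M$; $M(p)=\infty$ if no such $M$ exists. The $o(1)$ is a quantity tending to $0$ as $p\to\infty$. *)

(* Defs.v *)
From mathcomp Require Import all_boot all_order all_algebra.
From mathcomp Require Import all_classical all_reals all_analysis.

Set Implicit Arguments.
Unset Strict Implicit.
Unset Printing Implicit Defensive.

Import Order.TTheory GRing.Theory Num.Theory.

Definition smooth (y n : nat) : Prop :=
  forall q : nat, prime q -> q %| n -> q <= y.

Definition squarefree (n : nat) : Prop :=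
  forall q : nat, prime q -> ~~ (q ^ 2 %| n).

(* The positive p-smooth square-free integers up to N meet every residue class
   modulo p; [a] runs over all of nat, hence over every class, including 0. *)
Definition covers_residues (p N : nat) : Prop :=
  forall a : nat, exists n : nat,
    [/\ 0 < n <= N, smooth p n, squarefree n & n = a %[mod p]].

Lemma covers_residues_asbool (p : nat) :
  (exists N, covers_residues p N) -> exists N, `[< covers_residues p N >].
Proof. by case=> N hN; exists N; apply/asboolP. Qed.

(* Searching over nat loses nothing: a bound for positive representatives is
   itself positive. *)
Definition Msf (R : realType) (p : nat) : \bar R :=
  match pselect (exists N, covers_residues p N) with
  | left h => ((ex_minn (covers_residues_asbool h))%:R%:E)%R
  | right _ => +oo%E
  end.

(* Main.v *)
(** Take primes q1, q2 of size p^(1/4+o(1)) and let m in [1, p-1] represent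
    a/(q1 q2) modulo p. Then n = q1 q2 m is p-smooth, congruent to a and at most
    p^(3/2+o(1)), and it suffices that some pair (q1, q2) makes n squarefree.

    For small d, the condition d^2 | m says that a/(d^2 q1 q2) lies in [1, p/d^2]
    modulo p. This holds for a proportion close to 1/d^2 of the pairs, by a
    discrepancy estimate for u v + l = l' that needs no exponential sums:
    Cauchy-Schwarz replaces the families of the u's and of the v's by their
    differences, after which a second moment over the lines of the affine plane
    suffices; the input is that the reciprocals of the primes have minimal
    additive energy modulo p. Smoothing the interval costs a factor 9/8, and
    (9/8) sum_(d >= 2) 1/d^2 < 1, so a positive proportion of the pairs survives.

    A given n comes from boundedly many pairs, so for large d one counts n. Up to
    a threshold D near p^(1/2), n is determined modulo p d^2; beyond it, n = d^2 e
    with e small, and d is one of at most two square roots of a/e modulo p. *)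

Require Import Defs.
From mathcomp Require Import all_boot all_order all_algebra.
From mathcomp Require Import ring lra zify.
Set Implicit Arguments.
Unset Strict Implicit.
Unset Printing Implicit Defensive.
Import Order.TTheory GRing.Theory Num.Theory.
Local Open Scope ring_scope.

(** * Inequalities for finite sums *)

Lemma sum_sqr_pair (R : comPzRingType) (I : finType) (f : I -> R) :
  (\sum_i f i) ^+ 2 = \sum_i \sum_j f i * f j.
Proof. by rewrite expr2 big_distrlr. Qed.

(** Lagrange's identity: twice the defect is the sum of the squares of [f i * g j - f j * g i]. *)
Lemma sum_cauchy_schwarz (R : realFieldType) (I : finType) (f g : I -> R) :
  (\sum_i f i * g i) ^+ 2 <= (\sum_i f i ^+ 2) * (\sum_i g i ^+ 2).
Proof.
rewrite expr2 !big_distrlr /=.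
have H : 0 <= \sum_i \sum_j (f i * g j - f j * g i) ^+ 2.
  by apply: sumr_ge0 => i _; apply: sumr_ge0 => j _; apply: sqr_ge0.
have E : \sum_i \sum_j (f i * g j - f j * g i) ^+ 2 =
   (\sum_i \sum_j f i ^+ 2 * g j ^+ 2) + (\sum_i \sum_j f j ^+ 2 * g i ^+ 2)
   - (\sum_i \sum_j f i * g i * (f j * g j)) *+ 2.
  rewrite -sumrMnl -big_split /= -sumrB; apply: eq_bigr => i _.
  rewrite -sumrMnl -big_split /= -sumrB; apply: eq_bigr => j _.
  by ring.
move: H; rewrite E [X in _ + X - _]exchange_big /=; lra.
Qed.

Lemma sum_sqr_le_card (R : realFieldType) (I : finType) (f : I -> R) :
  (\sum_i f i) ^+ 2 <= #|I|%:R * \sum_i f i ^+ 2.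
Proof.
have := sum_cauchy_schwarz (fun=> 1) f.
under eq_bigr do rewrite mul1r.
by under [X in _ <= X * _ -> _]eq_bigr do rewrite expr1n; rewrite sumr_const.
Qed.

Lemma ler_sum_inj (R : numDomainType) (I J : finType) (h : I -> J) (f : J -> R) :
  injective h -> (forall j, 0 <= f j) -> \sum_i f (h i) <= \sum_j f j.
Proof.
move=> hinj f0; rewrite [leRHS](bigID (mem [set h x | x in [set: I]])) /=.
rewrite big_imset; last by move=> x y _ _; apply: hinj.
under [X in _ <= X + _]eq_bigl do rewrite inE.
by rewrite lerDl sumr_ge0.
Qed.

Lemma sum_eq_nat (R : pzSemiRingType) (T : finType) (x : T) :
  \sum_y (x == y)%:R = 1 :> R.
Proof. by rewrite (bigD1 x) //= eqxx big1 ?addr0 // => i /negPf; rewrite eq_sym => ->. Qed.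

(** * Solutions of u v + l = l' in a finite field *)

Section Discrepancy.
Variables (R : realFieldType) (F : finFieldType).

Definition hits (U V T T' : finType)
    (u : U -> F) (v : V -> F) (l : T -> F) (l' : T' -> F) : R :=
  \sum_i \sum_j \sum_t \sum_s (u i * v j + l t == l' s)%:R.

Definition discr (U V T T' : finType)
    (u : U -> F) (v : V -> F) (l : T -> F) (l' : T' -> F) : R :=
  hits u v l l' - (#|U| * #|V| * #|T| * #|T'|)%:R / #|F|%:R.

(** The second moment of the fibre sizes of [u]; for [differences u] it is the additive energy of
    [u]. *)
Definition coincidences (U : finType) (u : U -> F) : R := \sum_i \sum_j (u i == u j)%:R.

Definition differences (U : finType) (u : U -> F) (ij : U * U) : F := u ij.1 - u ij.2.

Let F0 : #|F|%:R != 0 :> R.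
Proof. by rewrite pnatr_eq0 -lt0n; apply/card_gt0P; exists 0. Qed.

Lemma discrC (U V T T' : finType)
    (u : U -> F) (v : V -> F) (l : T -> F) (l' : T' -> F) :
  discr u v l l' = discr v u l l'.
Proof.
rewrite /discr /hits exchange_big /=; congr (_ - _); last by rewrite (mulnC #|U|).
by under eq_bigr => j _ do under eq_bigr => i _ do rewrite mulrC.
Qed.

Lemma sum_eqM (x y : F) : \sum_z (x == z)%:R * (y == z)%:R = (x == y)%:R :> R.
Proof.
rewrite (bigD1 x) //= eqxx mul1r big1 ?addr0 1?eq_sym // => i /negPf.
by rewrite eq_sym => ->; rewrite mul0r.
Qed.

Lemma variance (J : finType) (w : J -> F) :
  \sum_x (\sum_j (w j == x)%:R - #|J|%:R / #|F|%:R) ^+ 2 =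
  coincidences w - #|J|%:R ^+ 2 / #|F|%:R.
Proof.
set c := _ / _.
have E1 : \sum_x \sum_j (w j == x)%:R = #|J|%:R :> R.
  by rewrite exchange_big /=; under eq_bigr do rewrite sum_eq_nat; rewrite sumr_const.
have E2 : \sum_x (\sum_j (w j == x)%:R) ^+ 2 = coincidences w.
  under eq_bigr do rewrite sum_sqr_pair.
  rewrite exchange_big /=; apply: eq_bigr => i _.
  by rewrite exchange_big /=; apply: eq_bigr => j _; rewrite sum_eqM.
under eq_bigr do rewrite sqrrB.
rewrite big_split /= sumrB sumrMnl -mulr_suml E1 E2 sumr_const /c -[_ *+ #|F|]mulr_natr.
by field.
Qed.

(** After Cauchy-Schwarz over [(i, s)], injectivity of [l'] lets [l' s] range over the whole field,
    where [variance] applies for each fixed [i]. The coincidences that remain are the solutions of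
    [u i * (v j - v j') + l t = l s], that is, [hits] for [differences v]. *)
Lemma discr_sqr_le (U V T T' : finType)
    (u : U -> F) (v : V -> F) (l : T -> F) (l' : T' -> F) :
  injective l' ->
  discr u v l l' ^+ 2 <= (#|U| * #|T'|)%:R * discr u (differences v) l l.
Proof.
move=> l'inj.
pose f i x := \sum_(jt : V * T) (u i * v jt.1 + l jt.2 == x)%:R - #|{: V * T}|%:R / #|F|%:R : R.
have E : discr u v l l' = \sum_(is_ : U * T') f is_.1 (l' is_.2).
  rewrite -(pair_big predT predT (fun i s => f i (l' s))) /= /discr /hits.
  have -> : (#|U| * #|V| * #|T| * #|T'|)%:R / #|F|%:R =
     \sum_(i : U) \sum_(s : T') (#|{: V * T}|%:R / #|F|%:R) :> R.
    by rewrite !sumr_const card_prod -!mulrnA -mulr_natr !natrM; field.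
  rewrite -sumrB; apply: eq_bigr => i _; rewrite sumrB; congr (_ - _).
  rewrite pair_big /= exchange_big /=; apply: eq_bigr => s _; exact: eq_bigr.
rewrite E; apply: le_trans (sum_sqr_le_card _) _.
rewrite card_prod ler_wpM2l ?ler0n //.
rewrite -(pair_big predT predT (fun i s => f i (l' s) ^+ 2)) /=.
have H i : \sum_s f i (l' s) ^+ 2 <= \sum_x f i x ^+ 2.
  by apply: (ler_sum_inj (f := fun x => f i x ^+ 2)) => // x; apply: sqr_ge0.
apply: le_trans (ler_sum _ (fun i _ => H i)) _.
under eq_bigr do rewrite variance.
rewrite sumrB sumr_const /discr le_eqVlt; apply/orP; left; apply/eqP; congr (_ - _); last first.
  by rewrite !card_prod -mulr_natr !natrM; field.
rewrite /hits /coincidences; apply: eq_bigr => i _.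
rewrite -(pair_big predT predT (fun j t =>
  \sum_(j0 : V * T) (u i * v j + l t == u i * v j0.1 + l j0.2)%:R)) /=.
rewrite -(pair_big predT predT (fun j j' =>
  \sum_t \sum_s (u i * differences v (j,j') + l t == l s)%:R)) /=.
apply: eq_bigr => j _.
under eq_bigr => t _ do rewrite -(pair_big predT predT (fun j' s =>
  (u i * v j + l t == u i * v j' + l s)%:R)) /=.
rewrite exchange_big /=; apply: eq_bigr => j' _.
apply: eq_bigr => t _; apply: eq_bigr => s _; congr (nat_of_bool _)%:R.
rewrite /differences /= -subr_eq0 -[RHS]subr_eq0; congr (_ == _); ring.
Qed.

Lemma coincidences_inj (U : finType) (u : U -> F) : injective u -> coincidences u = #|U|%:R.
Proof.
move=> uinj; rewrite /coincidences.
under eq_bigr => i _.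
  rewrite (bigD1 i) //= eqxx big1 ?addr0; last first.
    by move=> j /negPf ji; rewrite (inj_eq uinj) eq_sym ji.
  over.
by rewrite sumr_const.
Qed.

Lemma coincidences_ge0 (U : finType) (u : U -> F) : 0 <= coincidences u.
Proof. by apply: sumr_ge0 => i _; apply: sumr_ge0 => j _; apply: ler0n. Qed.

(* For [v i != v j] the pair [(x * v i + b, x * v j + b)] runs over [F * F] as
   [(x, b)] does, so such a pair contributes [(\sum_c g c) ^+ 2 = 0]. *)
Lemma sum_affine_sqr (V : finType) (v : V -> F) (g : F -> R) :
  \sum_c g c = 0 ->
  \sum_x \sum_b (\sum_j g (x * v j + b)) ^+ 2 =
  #|F|%:R * coincidences v * \sum_c g c ^+ 2.
Proof.
move=> g0; move SE: (\sum_c g c ^+ 2) => S.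
under eq_bigr => x _ do under eq_bigr => b _ do rewrite sum_sqr_pair.
under eq_bigr => x _ do rewrite exchange_big /=.
rewrite exchange_big /= /coincidences mulr_sumr mulr_suml; apply: eq_bigr => i _.
under eq_bigr => x _ do rewrite exchange_big /=.
rewrite exchange_big /= mulr_sumr mulr_suml; apply: eq_bigr => j _.
have sh x : \sum_b g (x * v i + b) * g (x * v j + b) =
    \sum_b g b * g (b + x * (v j - v i)).
  rewrite [RHS](reindex_inj (addrI (x * v i))) /=; apply: eq_bigr => b _.
  by congr (_ * g _); ring.
under eq_bigr do rewrite sh.
have [->|ne] := eqVneq (v i) (v j).
  under eq_bigr => x _ do under eq_bigr => b _ do rewrite subrr mulr0 addr0 -expr2.
  by rewrite SE sumr_const mulr1 mulr_natl.
rewrite mulr0 mul0r exchange_big /= big1 // => b _.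
rewrite -mulr_sumr [X in _ * X](_ : _ = 0) ?mulr0 // -[RHS]g0.
have inj : injective (fun x => b + x * (v j - v i)).
  by move=> x y /addrI /mulIf; apply; rewrite subr_eq0 eq_sym.
by rewrite [RHS](reindex_inj inj).
Qed.

(** Grouping the [i] by [x = u i] separates the multiplicity [r x] from a sum along [x * v j + b]
    with [b = l t]. After Cauchy-Schwarz over [(x, t)], [b] may range over the whole field, where
    [sum_affine_sqr] applies. *)
Lemma discr_sqr_le_coincidences (U V T T' : finType)
    (u : U -> F) (v : V -> F) (l : T -> F) (l' : T' -> F) :
  injective l -> injective l' ->
  discr u v l l' ^+ 2 <=
  (#|T| * #|T'| * #|F|)%:R * coincidences u * coincidences v.
Proof.
move=> linj l'inj.
(* Subtracting the mean makes [g] sum to 0, as [sum_affine_sqr] requires. *)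
pose g c : R := \sum_s (l' s == c)%:R - #|T'|%:R / #|F|%:R.
have g0 : \sum_c g c = 0.
  rewrite sumrB exchange_big /=; under eq_bigr do rewrite sum_eq_nat.
  by rewrite !sumr_const -[_ *+ #|F|]mulr_natr; field.
have g2 : \sum_c g c ^+ 2 <= #|T'|%:R.
  by rewrite variance coincidences_inj // gerBl divr_ge0 // ?exprn_ge0 // ler0n.
pose G x b := \sum_j g (x * v j + b).
pose r x : R := \sum_i (u i == x)%:R.
have E : discr u v l l' = \sum_(xt : F * T) r xt.1 * G xt.1 (l xt.2).
  rewrite -(pair_big predT predT (fun x t => r x * G x (l t))) /= /r.
  under eq_bigr => x _ do rewrite -mulr_sumr mulr_suml.
  rewrite exchange_big /=.
  transitivity (\sum_i \sum_t G (u i) (l t)); last first.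
    apply: eq_bigr => i _; rewrite (bigD1 (u i)) //= eqxx mul1r [X in _ + X]big1 ?addr0 //.
    by move=> x /negPf; rewrite eq_sym => ->; rewrite mul0r.
  have -> : discr u v l l' = hits u v l l' -
     \sum_(i : U) \sum_(t : T) \sum_(j : V) #|T'|%:R / #|F|%:R.
    by rewrite /discr !sumr_const -!mulrnA -mulr_natr !natrM; congr (_ - _); field.
  rewrite /hits -sumrB; apply: eq_bigr => i _.
  rewrite exchange_big /= -sumrB; apply: eq_bigr => t _.
  rewrite -sumrB; apply: eq_bigr => j _; rewrite /g; congr (_ - _).
  by apply: eq_bigr => s _; rewrite eq_sym.
rewrite E; apply: le_trans (sum_cauchy_schwarz _ _) _.
have -> : \sum_(xt : F * T) r xt.1 ^+ 2 = #|T|%:R * coincidences u.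
  rewrite -(pair_big predT predT (fun x t => r x ^+ 2)) /=.
  under eq_bigr do rewrite sumr_const -mulr_natl.
  rewrite -mulr_sumr; congr (_ * _); rewrite /r.
  under eq_bigr do rewrite sum_sqr_pair.
  rewrite exchange_big /=; apply: eq_bigr => i _.
  by rewrite exchange_big /=; apply: eq_bigr => j _; rewrite sum_eqM.
have H : \sum_(xt : F * T) G xt.1 (l xt.2) ^+ 2 <= #|F|%:R * coincidences v * #|T'|%:R.
  rewrite -(pair_big predT predT (fun x t => G x (l t) ^+ 2)) /=.
  apply: le_trans (_ : \sum_x \sum_b G x b ^+ 2 <= _).
    apply: ler_sum => x _; apply: (ler_sum_inj (f := fun b => G x b ^+ 2)) => // b.
    exact: sqr_ge0.
  by rewrite sum_affine_sqr // ler_wpM2l // mulr_ge0 ?ler0n ?coincidences_ge0.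
apply: le_trans (ler_wpM2l _ H) _; first by rewrite mulr_ge0 ?ler0n ?coincidences_ge0.
rewrite !natrM; rewrite le_eqVlt; apply/orP; left; apply/eqP; ring.
Qed.

(* Both families are replaced by their differences before the second-moment
   bound is applied; each step costs one squaring, whence the eighth power. *)
Lemma discr_expr8_le (U V T T' : finType)
    (u : U -> F) (v : V -> F) (l : T -> F) (l' : T' -> F) :
  injective l -> injective l' ->
  discr u v l l' ^+ 8 <=
  (#|U| ^ 4 * #|V| ^ 4 * #|T| ^ 4 * #|T'| ^ 4 * #|F|)%:R *
  (coincidences (differences u) * coincidences (differences v)).
Proof.
move=> linj l'inj.
set d1 := discr u (differences v) l l.
set d2 := discr (differences v) (differences u) l l.
have h1 : discr u v l l' ^+ 2 <= (#|U| * #|T'|)%:R * d1 by apply: discr_sqr_le.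
(* [discrC] exchanges the two families, so that this time [u] is differenced. *)
have h2 : d1 ^+ 2 <= (#|V| ^ 2 * #|T|)%:R * d2.
  have := discr_sqr_le (differences v) u l linj.
  by rewrite -discrC card_prod.
have h3 : d2 ^+ 2 <= (#|T| * #|T| * #|F|)%:R *
    coincidences (differences v) * coincidences (differences u).
  exact: discr_sqr_le_coincidences.
(* Squaring [h1] is legitimate: its right-hand side dominates a square, hence is nonnegative. *)
have h1' : discr u v l l' ^+ 4 <= ((#|U| * #|T'|)%:R * d1) ^+ 2.
  rewrite (exprM _ 2 2) ler_sqr ?nnegrE ?sqr_ge0 //; exact: le_trans (sqr_ge0 _) h1.
have h1'' : discr u v l l' ^+ 4 <= (#|U| * #|T'|)%:R ^+ 2 * ((#|V| ^ 2 * #|T|)%:R * d2).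
  by apply: le_trans h1' _; rewrite exprMn ler_wpM2l // sqr_ge0.
have h0 : 0 <= discr u v l l' ^+ 4 by rewrite (exprM _ 2 2) sqr_ge0.
have h4 : discr u v l l' ^+ 8 <= ((#|U| * #|T'|)%:R ^+ 2 * ((#|V| ^ 2 * #|T|)%:R * d2)) ^+ 2.
  by rewrite (exprM _ 4 2) ler_sqr ?nnegrE //; exact: le_trans h1''.
apply: le_trans h4 _.
have -> : ((#|U| * #|T'|)%:R ^+ 2 * ((#|V| ^ 2 * #|T|)%:R * d2)) ^+ 2 =
   ((#|U| * #|T'|)%:R ^+ 2 * (#|V| ^ 2 * #|T|)%:R) ^+ 2 * d2 ^+ 2 by ring.
apply: le_trans (ler_wpM2l (sqr_ge0 _) h3) _.
rewrite le_eqVlt; apply/orP; left; apply/eqP; rewrite !natrM; ring.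
Qed.

End Discrepancy.

(** * Products of reciprocals of primes in short intervals *)

(* The hypothesis is 1/a + 1/d = 1/b + 1/c with denominators cleared. *)
Lemma prime_fraction_sums (a b c d : nat) :
  prime a -> prime b -> prime c -> prime d ->
  ((a + d) * (b * c) = (b + c) * (a * d))%N ->
  (a = b /\ d = c) \/ (a = c /\ d = b).
Proof.
move=> pa pb pc pd e.
have := prime_gt0 pa; have := prime_gt0 pb; have := prime_gt0 pc; have := prime_gt0 pd.
move=> d0 c0 b0 a0.
have Hab : a = b -> (a = b /\ d = c) \/ (a = c /\ d = b).
  by move=> ab; left; split=> //; subst b; nia.
(* Since [a] divides the right-hand side, it divides [d * b * c] and is one of the other three
   primes. *)
have dv : (a %| d * (b * c))%N.
  rewrite -(@dvdn_addr (a * (b * c))) ?dvdn_mulr // -mulnDl e.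
  by rewrite dvdn_mull // dvdn_mulr.
move: dv; rewrite !Euclid_dvdM // !dvdn_prime2 // => /orP[/eqP ad|/orP[/eqP|/eqP ac]].
- subst d.
  have e' : (2 * (b * c) = (b + c) * a)%N.
    by apply/eqP; rewrite -(eqn_pmul2l a0); apply/eqP; rewrite -[RHS]mulnCA -e; ring.
  have dv : (b %| c * a)%N.
    rewrite -(@dvdn_addr (b * a)) ?dvdn_mulr // -mulnDl -e'.
    by rewrite dvdn_mull // dvdn_mulr.
  move: dv; rewrite Euclid_dvdM // !dvdn_prime2 // => /orP[/eqP bc|/eqP ba].
    by subst c; left; split; nia.
  exact: Hab.
- exact: Hab.
- by right; split=> //; subst c; nia.
Qed.

Lemma Fp_natr_eq (p m n : nat) : prime p -> (m < p)%N -> (n < p)%N ->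
  (m%:R == n%:R :> 'F_p) = (m == n).
Proof. by move=> pp mp np; rewrite -val_eqE /= !val_Fp_nat // !modn_small. Qed.

Lemma Fp_natr_neq0 (p n : nat) : prime p -> (0 < n < p)%N -> n%:R != 0 :> 'F_p.
Proof.
move=> pp /andP[n0 np].
by have := Fp_natr_eq pp np (prime_gt0 pp); rewrite mulr0n => ->; rewrite -lt0n.
Qed.

(** With denominators cleared, both sides of a relation between four reciprocals are integers at
    most [2 * N ^ 3 < p], so congruence is equality and [prime_fraction_sums] applies. Only the two
    trivial families of quadruples remain, each of size [#|I| ^ 2]. *)
Lemma reciprocal_energy (R : realFieldType) (p N : nat) (I : finType) (q : I -> nat) (c : 'F_p) :
  prime p -> (2 * N ^ 3 < p)%N -> injective q ->
  (forall i, prime (q i)) -> (forall i, (q i <= N)%N) -> c != 0 ->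
  coincidences R (differences (fun i => c / (q i)%:R)) <= (2 * #|I| ^ 2)%:R.
Proof.
move=> pp Np qinj qp qN c0.
have q0 i : (0 < q i)%N by exact: prime_gt0.
have NN (x y z : I) : (q x * (q y * q z) <= N ^ 3)%N by rewrite (expnD N 1 2) !leq_mul.
have qF i : (q i)%:R != 0 :> 'F_p.
  by apply: Fp_natr_neq0 => //; rewrite q0 /=; have := NN i i i; have := q0 i; nia.
set u := fun i => _.
have key i j k l : u i - u j = u k - u l -> (i = j /\ k = l) \/ (i = k /\ j = l).
  move=> e.
  have e' : ((q i + q l) * (q j * q k) = (q j + q k) * (q i * q l))%N.
    apply/eqP; rewrite -(@Fp_natr_eq p) //; last 2 first.
    - by rewrite mulnDl; have := NN i j k; have := NN l j k; lia.
    - by rewrite mulnDl; have := NN j i l; have := NN k i l; lia.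
    apply/eqP; rewrite !natrM !natrD.
    have E : u i + u l = u j + u k by move/eqP: e; rewrite subr_eq addrAC -addrA => /eqP ->; ring.
    have := congr1 (fun x => x / c * ((q i)%:R * (q j)%:R * (q k)%:R * (q l)%:R)) E.
    have -> : (u i + u l) / c * ((q i)%:R * (q j)%:R * (q k)%:R * (q l)%:R) =
        ((q i)%:R + (q l)%:R) * ((q j)%:R * (q k)%:R).
      by rewrite /u; field; rewrite c0 !qF.
    move=> ->; rewrite /u; field; by rewrite c0 !qF.
  case: (prime_fraction_sums (qp i) (qp j) (qp k) (qp l) e') => -[/qinj h1 /qinj h2].
    by left.
  by right.
have H (ij kl : I * I) : (differences u ij == differences u kl)%:R <=
   (ij.1 == ij.2)%:R * (kl.1 == kl.2)%:R + (ij.1 == kl.1)%:R * (ij.2 == kl.2)%:R :> R.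
  case: ij kl => i j [k l]; rewrite /differences /=; case: eqP => [e|_]; last first.
    by rewrite addr_ge0 // mulr_ge0.
  by case: (key _ _ _ _ e) => -[-> ->]; rewrite !eqxx mulr1 ?lerDl ?lerDr mulr_ge0.
apply: le_trans (ler_sum _ (fun ij _ => ler_sum _ (fun kl _ => H ij kl))) _.
have S2 : \sum_(ij : I * I) (ij.1 == ij.2)%:R = #|I|%:R :> R.
  rewrite -(pair_big predT predT (fun i j : I => (i == j)%:R)) /=.
  by under eq_bigr do rewrite sum_eq_nat; rewrite sumr_const.
under eq_bigr do rewrite big_split /= -mulr_sumr S2.
rewrite big_split /= -mulr_suml S2.
have -> : \sum_(i : I * I) \sum_(j : I * I) (i.1 == j.1)%:R * (i.2 == j.2)%:R = #|I|%:R ^+ 2 :> R.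
  under eq_bigr => i _.
    rewrite -(pair_big predT predT (fun j1 j2 : I => (i.1 == j1)%:R * (i.2 == j2)%:R)) /=.
    under eq_bigr do rewrite -mulr_sumr sum_eq_nat mulr1.
    rewrite sum_eq_nat.
    over.
  by rewrite sumr_const card_prod natrM.
by rewrite natrM natrX; lra.
Qed.

(** Smoothing: a quotient [x] in [[1, X]] gives [L] solutions of [x + t = s] with [t < L] and [s] in
    [[1, X + L]]. Hence [L] times the count is at most [hits], whose expected value carries the
    factor [X + L <= 9 / 8 * X]. *)
Lemma count_quotients_small (R : realFieldType) (p N z X : nat)
    (I : finType) (q : I -> nat) (c : 'F_p) :
  prime p -> (2 * N ^ 3 < p)%N -> injective q ->
  (forall i, prime (q i)) -> (forall i, (q i <= N)%N) -> c != 0 ->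
  (8 <= X)%N -> (2 * X < p)%N -> (0 < z)%N ->
  (4 * (32 * z) ^ 8 * 17 ^ 4 * p <= #|I| ^ 4)%N ->
  #|[set ij : I * I | (0 < (c / ((q ij.1)%:R * (q ij.2)%:R))%R <= X)%N]|%:R <=
  9 / 8 * (#|I| ^ 2)%:R * (X%:R / p%:R) + (#|I| ^ 2)%:R / (32 * z)%:R :> R.
Proof.
move=> pp Np qinj qp qN c0 X8 Xp z0 Kp.
set K := #|I|; set S := [set _ | _].
pose L := (X %/ 8)%N.
have L0 : (0 < L)%N by rewrite divn_gt0.
have [LX XL] : (8 * L <= X)%N /\ (X + L <= 17 * L)%N.
  by rewrite /L; split; lia.
have p0 : (0 < p)%N by exact: prime_gt0.
pose u i : 'F_p := c / (q i)%:R.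
pose v i : 'F_p := 1 / (q i)%:R.
pose l (t : 'I_L) : 'F_p := t%:R.
pose l' (s : 'I_(X + L)) : 'F_p := s.+1%:R.
have linj : injective l.
  move=> s t /eqP; rewrite Fp_natr_eq //; first by move/eqP/val_inj.
    by have := ltn_ord s; lia.
  by have := ltn_ord t; lia.
have l'inj : injective l'.
  move=> s t /eqP; rewrite Fp_natr_eq //; first by rewrite eqSS; move/eqP/val_inj.
    by have := ltn_ord s; lia.
  by have := ltn_ord t; lia.
have pFp : #|('F_p : finFieldType)| = p := card_Fp pp.
have hitsS : (#|S| * L)%:R <= hits R u v l l'.
  rewrite /hits pair_big /= (bigID (mem S)) /= -[leLHS]addr0.
  apply: lerD; last first.
    by apply: sumr_ge0 => i _; apply: sumr_ge0 => j _; apply: sumr_ge0.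
  have -> : (#|S| * L)%:R = \sum_(ij in S) \sum_(t : 'I_L) 1 :> R.
    by rewrite !sumr_const card_ord -mulrnA mulnC.
  apply: ler_sum => -[i j]; rewrite inE [(i, j).1]/= [(i, j).2]/= => /andP[x0 xX].
  apply: ler_sum => t _.
  set x := nat_of_ord (c / _) in x0 xX.
  have sb : ((x + t).-1 < X + L)%N by have := ltn_ord t; lia.
  rewrite (bigD1 (Ordinal sb)) //=.
  have -> : u i * v j + l t == l' (Ordinal sb).
    have -> : u i * v j = x%:R by rewrite /x natr_Zp /u /v mul1r invfM mulrA.
    by rewrite /l /l' /= -natrD prednK // addn_gt0 x0.
  by rewrite lerDl sumr_ge0.
have D8 : discr R u v l l' ^+ 8 <=
   (K ^ 4 * K ^ 4 * L ^ 4 * (X + L) ^ 4 * p)%:R * ((2 * K ^ 2)%:R * (2 * K ^ 2)%:R).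
  have := discr_expr8_le R u v linj l'inj.
  rewrite pFp !card_ord => /le_trans; apply.
  rewrite ler_wpM2l ?ler0n // ler_pM ?coincidences_ge0 //;
    apply: (reciprocal_energy R pp Np) => //; exact: oner_neq0.
(* Compare eighth powers: since [X + L <= 17 * L], the factor [L ^ 8] cancels, [K ^ 16] stands
   against [K ^ 12], and what remains is the hypothesis [Kp]. *)
have D : discr R u v l l' <= (K ^ 2 * L)%:R / (32 * z)%:R.
  rewrite leNgt; apply/negP => lt.
  have z32 : 0 < (32 * z)%:R :> R by rewrite ltr0n muln_gt0.
  have y0 : 0 <= (K ^ 2 * L)%:R / (32 * z)%:R :> R by rewrite divr_ge0.
  have : ((K ^ 2 * L)%:R / (32 * z)%:R) ^+ 8 < discr R u v l l' ^+ 8.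
    by rewrite ltrXn2r // ltW.
  move=> /lt_le_trans/(_ D8); rewrite expr_div_n ltr_pdivrMr ?exprn_gt0 //.
  rewrite -!natrX -!natrM ltr_nat ltnNge => /negP; apply.
  have h1 : ((X + L) ^ 4 <= (17 * L) ^ 4)%N by rewrite leq_exp2r.
  apply: leq_trans (_ : K ^ 4 * K ^ 4 * L ^ 4 * (17 * L) ^ 4 * p *
    (2 * K ^ 2 * (2 * K ^ 2)) * (32 * z) ^ 8 <= _)%N.
    by rewrite !leq_mul2r; apply/orP; right; apply/orP; right; apply/orP; right; rewrite leq_mul2l h1 orbT.
  have -> : (K ^ 4 * K ^ 4 * L ^ 4 * (17 * L) ^ 4 * p * (2 * K ^ 2 * (2 * K ^ 2)) * (32 * z) ^ 8 =
     (K ^ 4 * K ^ 4 * K ^ 4 * L ^ 8) * (4 * (32 * z) ^ 8 * 17 ^ 4 * p))%N.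
    by rewrite !expnMn; move: (32 ^ 8)%N (17 ^ 4)%N => A B; ring.
  have -> : ((K ^ 2 * L) ^ 8 = (K ^ 4 * K ^ 4 * K ^ 4 * L ^ 8) * K ^ 4)%N by rewrite expnMn; ring.
  by rewrite leq_mul2l Kp orbT.
have Lr : 0 < L%:R :> R by rewrite ltr0n.
rewrite -(ler_pM2r Lr) -natrM; apply: le_trans hitsS _.
move: D; rewrite /discr pFp !card_ord lerBlDr => /le_trans; apply.
rewrite mulrDl addrC; apply: lerD; last by rewrite natrM mulrAC.
have XL8 : (X + L)%:R <= 9 / 8 * X%:R :> R.
  by have : (8 * L)%:R <= X%:R :> R; [rewrite ler_nat | rewrite natrD natrM; lra].
have A0 : 0 <= (K ^ 2)%:R * L%:R / p%:R :> R by rewrite divr_ge0 ?mulr_ge0.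
have -> : (K * K * L * (X + L))%:R / p%:R = (K ^ 2)%:R * L%:R / p%:R * (X + L)%:R :> R.
  by rewrite !natrM; ring.
have -> : 9 / 8 * (K ^ 2)%:R * (X%:R / p%:R) * L%:R =
   (K ^ 2)%:R * L%:R / p%:R * (9 / 8 * X%:R) :> R by ring.
exact: ler_wpM2l.
Qed.

(** * Pairs of primes yielding a squarefree number *)

Lemma card_has_le (T : finType) (r : seq nat) (P : nat -> pred T) :
  (#|[set x | has (P^~ x) r]| <= \sum_(d <- r) #|[set x | P d x]|)%N.
Proof.
elim: r => [|d r IH] /=; first by rewrite big_nil; under eq_finset do rewrite /=; rewrite cards0.
rewrite big_cons; have -> : [set x | P d x || has (P^~ x) r] =
  [set x | P d x] :|: [set x | has (P^~ x) r] by apply/setP => x; rewrite !inE.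
by apply: leq_trans (leq_card_setU _ _) _; rewrite leq_add2l.
Qed.

Lemma card_le_fibers (S T : finType) (A : {set S}) (f : S -> T) (b : nat) :
  (forall y, y \in f @: A -> #|[set x in A | f x == y]| <= b)%N ->
  (#|A| <= b * #|f @: A|)%N.
Proof.
move=> H; rewrite -sum1_card (partition_big_imset f) /= mulnC -sum_nat_const.
apply: leq_sum => y yA; apply: leq_trans (H y yA).
by rewrite -sum1_card; apply: eq_leq; apply: eq_bigl => x; rewrite inE.
Qed.

Lemma prod_primes_dvdn (I : finType) (q : I -> nat) (A : {set I}) (n : nat) :
  injective q -> (forall i, prime (q i)) -> (forall i, i \in A -> q i %| n)%N ->
  (\prod_(i in A) q i %| n)%N.
Proof.
move=> qinj qp; rewrite -big_enum => /= dA.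
have {dA} : forall i, i \in enum A -> (q i %| n)%N by move=> i; rewrite mem_enum => /dA.
elim: (enum A) (enum_uniq A) => [|i s IH] /=; first by rewrite big_nil dvd1n.
case/andP=> is_ us dis; rewrite big_cons Gauss_dvd; last first.
  rewrite prime_coprime //; elim: s is_ {IH us dis} => [|j s IHs].
    by rewrite big_nil => _; rewrite dvdn1; apply/eqP => qi1; move: (qp i); rewrite qi1.
  rewrite inE negb_or => /andP[ij is_].
  by rewrite big_cons Euclid_dvdM // dvdn_prime2 // (inj_eq qinj) (negPf ij) /= IHs.
by rewrite dis ?mem_head //= IH // => j js; apply: dis; rewrite inE js orbT.
Qed.

(** The product of the [q i] dividing [n] divides [n], and each factor exceeds [z]. This bounds the
    number of pairs that produce the same [n]. *)
Lemma card_prime_divisors_lt (I : finType) (q : I -> nat) (z n w : nat) :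
  injective q -> (forall i, prime (q i)) -> (forall i, z < q i)%N -> (1 < z)%N ->
  (0 < n < z ^ w)%N -> (#|[set i | q i %| n]| < w)%N.
Proof.
move=> qinj qp zq z1 /andP[n0 nw]; set A := finset _.
rewrite -(ltn_exp2l _ _ z1); apply: leq_ltn_trans nw.
have dn : (\prod_(i in A) q i %| n)%N.
  by apply: prod_primes_dvdn => // i; rewrite inE.
apply: leq_trans (dvdn_leq n0 dn); rewrite -prod_nat_const.
by apply: leq_prod => i _; apply: ltnW.
Qed.

(** Telescoping, by comparison of [1 / (d + 1) ^ 2] with [1 / d - 1 / (d + 1)]. *)
Lemma sum_inv_sqr_le (R : realFieldType) (z D : nat) : (0 < z)%N -> (z <= D)%N ->
  \sum_(z.+1 <= d < D.+1) (d%:R ^+ 2)^-1 <= z%:R^-1 - D%:R^-1 :> R.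
Proof.
move=> z0; elim: D => [|D IH] zD; first by lia.
move: zD; rewrite leq_eqVlt => /orP[/eqP <-|zD].
  by rewrite big_geq // subrr.
rewrite big_nat_recr //=; have D0 : 0 < D%:R :> R by rewrite ltr0n; lia.
apply: le_trans (lerD (IH zD) (lexx _)) _.
suff : (D.+1%:R ^+ 2)^-1 <= D%:R^-1 - D.+1%:R^-1 :> R.
  by move: (D.+1%:R ^- 2) (D%:R^-1) (D.+1%:R^-1) => x y t; lra.
have -> : D.+1%:R = D%:R + 1 :> R by rewrite -natr1.
have -> : D%:R^-1 - (D%:R + 1)^-1 = (D%:R * (D%:R + 1))^-1 :> R by field; lra.
rewrite lef_pV2 ?posrE; [by nra|by nra|by nra].
Qed.

(** By the Chinese remainder theorem such an [n] is determined modulo [p * d], hence by its quotient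
    by [p * d]. *)
Lemma card_progression_le (p d a B : nat) : (0 < d)%N -> coprime p d ->
  (#|[set n : 'I_B | (d %| n) && (n == a %[mod p])]| <= (B %/ (p * d)).+1)%N.
Proof.
move=> d0 pd; pose f (n : 'I_B) : 'I_(B %/ (p * d)).+1 := inord (n %/ (p * d)).
rewrite -[leqRHS]card_ord -(card_in_imset (f := f)) ?max_card //.
move=> m n; rewrite !inE => /andP[dm /eqP ma] /andP[dn /eqP na] /(congr1 val).
have le (x : 'I_B) : (x %/ (p * d) < (B %/ (p * d)).+1)%N by rewrite ltnS leq_div2r // ltnW.
rewrite /= !inordK // => e; apply/val_inj => /=.
have : m == n %[mod p * d].
  by rewrite chinese_remainder // ma na eqxx (eqP dm) (eqP dn) eqxx.
by rewrite (divn_eq m (p * d)) (divn_eq n (p * d)) e !modnMDl !modn_mod => /eqP ->.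
Qed.

(** Since [a] is nonzero, [e] is invertible, so [d] is a square root of [a / e] in the field; being
    less than [p], it is determined by its class. *)
Lemma card_sqr_multiples_le (p e B : nat) (a : 'F_p) : prime p -> a != 0 ->
  (B <= p ^ 2)%N ->
  (#|[set n : 'I_B | ((n : nat)%:R == a) &&
       [exists d : 'I_p, n == d ^ 2 * e :> nat]]| <= 2)%N.
Proof.
move=> pp a0 Bp; set A := finset _.
case: (set_0Vmem A) => [->|[n0]]; first by rewrite cards0.
rewrite inE => /andP[/eqP n0a /existsP[d0 /eqP n0d]].
pose x0 : 'F_p := (d0 : nat)%:R.
have e0 : e%:R != 0 :> 'F_p.
  by apply: contraNneq a0 => e0; rewrite -n0a n0d natrM e0 mulr0.
pose g (x : 'F_p) : nat := ((x : nat) ^ 2 * e)%N.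
have sub : {subset [seq nat_of_ord n | n in A] <= [:: g x0; g (- x0)]}.
  move=> m /mapP[n]; rewrite mem_enum inE => /andP[/eqP na /existsP[d /eqP nd]] ->.
  pose x : 'F_p := (d : nat)%:R.
  have xd : (x : nat) = d by rewrite /x /= val_Fp_nat // modn_small.
  have -> : n = g x :> nat by rewrite /g xd.
  have : x ^+ 2 == x0 ^+ 2.
    rewrite -(inj_eq (mulIf e0)) /x /x0 -!natrX -!natrM -nd -n0d na n0a //.
  by rewrite eqf_sqr => /orP[]/eqP->; rewrite !inE eqxx ?orbT.
rewrite -(size_image (@nat_of_ord B) A).
have := uniq_leq_size _ sub; apply.
by rewrite map_inj_uniq ?enum_uniq //; exact: val_inj.
Qed.

Section GoodPair.
Variables (p N z D w : nat) (I : finType) (q : I -> nat) (a : 'F_p).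
Hypotheses (pp : prime p) (qinj : injective q) (qp : forall i, prime (q i)).
Hypotheses (qN : forall i, (q i <= N)%N) (zq : forall i, (z < q i)%N).
Hypotheses (a0 : a != 0) (Np : (2 * N ^ 3 < p)%N) (z1 : (1 < z)%N).
Hypotheses (zD : (z <= D)%N) (Dp : (D < p)%N) (zp : (8 * z ^ 2 <= p)%N).
Hypothesis zw : (p * N ^ 2 <= z ^ w)%N.

Let m (ij : I * I) : nat := (a / ((q ij.1)%:R * (q ij.2)%:R) : 'F_p).
Let n (ij : I * I) : nat := (q ij.1 * q ij.2 * m ij)%N.

Let qlt i : (q i < p)%N.
Proof.
apply: leq_ltn_trans (qN i) _; apply: leq_ltn_trans Np.
case: N => // N'; rewrite -{1}(muln1 N'.+1) (expnS _ 2) mulnA (mulnC 2%N) -mulnA leq_mul2l /=.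
by rewrite muln_gt0 expn_gt0.
Qed.

Let qF i : (q i)%:R != 0 :> 'F_p.
Proof. by rewrite Fp_natr_neq0 // prime_gt0 //= qlt. Qed.

Let mlt ij : (m ij < p)%N.
Proof. by rewrite -[X in (_ < X)%N](Fp_cast pp) ltn_ord. Qed.

Let mF ij : (m ij)%:R = a / ((q ij.1)%:R * (q ij.2)%:R) :> 'F_p.
Proof. by rewrite natr_Zp. Qed.

Let m0 ij : (0 < m ij)%N.
Proof.
rewrite lt0n; apply: contra a0 => /eqP mz.
have := mF ij; rewrite mz mulr0n => /esym/eqP.
by rewrite !mulf_eq0 invr_eq0 mulf_eq0 !(negPf (qF _)) !orbF.
Qed.

Let nF ij : (n ij)%:R = a :> 'F_p.
Proof. by rewrite /n !natrM mF; field; rewrite !qF. Qed.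

Let n0 ij : (0 < n ij)%N.
Proof. by rewrite !muln_gt0 m0 !prime_gt0. Qed.

Let nlt ij : (n ij < p * N ^ 2)%N.
Proof.
have N0 : (0 < N)%N by apply: leq_trans (qN ij.1); rewrite prime_gt0.
apply: leq_ltn_trans (_ : N * N * m ij < _)%N; first by rewrite leq_mul2r leq_mul ?orbT.
by rewrite mulnC mulnn ltn_pmul2r ?mlt // expn_gt0 N0.
Qed.

Let NP : (N ^ 2 <= p)%N.
Proof. by case: N Np => [|N'] h; first by []; move: h; rewrite !expnS expn0; nia. Qed.

(** If [m = d ^ 2 * e], then [e <= p / d ^ 2] represents [a / d ^ 2] divided by the two primes, so
    [count_quotients_small] applies with [c = a / d ^ 2]. *)
Lemma card_small_square_le (R : realFieldType) d : (2 <= d <= z)%N ->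
  (4 * (32 * z) ^ 8 * 17 ^ 4 * p <= #|I| ^ 4)%N ->
  #|[set ij | (d ^ 2 %| m ij)%N]|%:R <=
  9 / 8 * (#|I| ^ 2)%:R * (d%:R ^+ 2)^-1 + (#|I| ^ 2)%:R / (32 * z)%:R :> R.
Proof.
move=> /andP[d2 dz] Kp; set X := (p %/ d ^ 2)%N.
have dd : (4 <= d ^ 2)%N by rewrite (leq_exp2r 2 d (isT : (0 < 2)%N)).
have ddz : (d ^ 2 <= z ^ 2)%N by rewrite leq_exp2r.
have X8 : (8 <= X)%N by rewrite leq_divRL; [nia|lia].
have Xd : (X * d ^ 2 <= p)%N by exact: leq_trunc_div.
have Xp : (2 * X < p)%N by nia.
have dF : d%:R != 0 :> 'F_p by rewrite Fp_natr_neq0 //; apply/andP; split; lia.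
have c0 : a / d%:R ^+ 2 != 0 by rewrite mulf_neq0 // invr_eq0 expf_neq0.
have := count_quotients_small R pp Np qinj qp qN c0 X8 Xp (ltnW z1) Kp.
set S := (X in #|X|) => hS.
have sub : [set ij | (d ^ 2 %| m ij)%N] \subset S.
  apply/subsetP => ij; rewrite !inE => /dvdnP[e me].
  have e0 : (0 < e)%N by have := m0 ij; rewrite me muln_gt0 => /andP[].
  have eX : (e <= X)%N.
    by rewrite /X leq_divRL ?(leq_trans _ dd) // -me ltnW ?mlt.
  have -> : a / d%:R ^+ 2 / ((q ij.1)%:R * (q ij.2)%:R) = e%:R.
    apply: (mulIf (expf_neq0 2 dF)); rewrite -natrX -[RHS]natrM -me mF natrX.
    by field; rewrite dF !qF.
  rewrite val_Fp_nat // modn_small ?e0 //.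
  by apply: leq_ltn_trans eX _; lia.
apply: le_trans (_ : #|S|%:R <= _); first by rewrite ler_nat subset_leq_card.
have r0 : 0 <= 9 / 8 :> R by lra.
apply: le_trans hS _; rewrite lerD2r ler_wpM2l ?(mulr_ge0 r0) //.
have pr : 0 < p%:R :> R by rewrite ltr0n prime_gt0.
have dr : 0 < d%:R ^+ 2 :> R by rewrite exprn_gt0 // ltr0n; lia.
by rewrite ler_pdivrMr // mulrC ler_pdivlMr // -natrX -natrM ler_nat.
Qed.

Let small (ij : I * I) : bool := has (fun d => d ^ 2 %| m ij)%N (index_iota 2 z.+1).

(** The sum of [1 / d ^ 2] is at most 1/4 + 1/2, so the main terms contribute 9/8 * 3/4 = 27/32; the
    error terms, fewer than [z] in number, add at most 1/32. *)
Lemma card_small_squares_le (R : realFieldType) :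
  (4 * (32 * z) ^ 8 * 17 ^ 4 * p <= #|I| ^ 4)%N ->
  #|[set ij | small ij]|%:R <= 7 / 8 * (#|I| ^ 2)%:R :> R.
Proof.
move=> Kp.
apply: le_trans (_ : \sum_(2 <= d < z.+1) #|[set ij | (d ^ 2 %| m ij)%N]|%:R <= _).
  by rewrite -natr_sum ler_nat; apply: card_has_le.
apply: le_trans (_ : \sum_(2 <= d < z.+1) (9 / 8 * (#|I| ^ 2)%:R * (d%:R ^+ 2)^-1 +
    (#|I| ^ 2)%:R / (32 * z)%:R) <= _).
  rewrite big_nat [leRHS]big_nat; apply: ler_sum => d dz.
  exact: card_small_square_le.
rewrite big_split /= -mulr_sumr sumr_const_nat -[X in _ + X <= _]mulr_natr big_ltn //.
have z2 := sum_inv_sqr_le R (isT : (0 < 2)%N) z1.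
have zr : 0 < z%:R :> R by rewrite ltr0n ltnW.
have h : (z.+1 - 2)%:R / z%:R <= 1 :> R.
  by rewrite ler_pdivrMr // mul1r ler_nat; lia.
set Q := (#|I| ^ 2)%:R.
have Q0 : 0 <= Q by [].
have -> : Q / (32 * z)%:R * (z.+1 - 2)%:R = Q * ((z.+1 - 2)%:R / z%:R) / 32.
  by rewrite natrM; field; rewrite gt_eqF.
have h1 := ler_wpM2l Q0 h.
have h2 : 2%:R ^- 2 + \sum_(3 <= i < z.+1) i%:R ^- 2 <= 3 / 4 :> R.
  have zi : 0 <= z%:R^-1 :> R by rewrite invr_ge0.
  have -> : 2%:R ^- 2 = 1 / 4 :> R by field.
  lra.
have c0 : 0 <= 9 / 8 :> R by lra.
have h3 := ler_wpM2l (mulr_ge0 c0 Q0) h2.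
lra.
Qed.

(** Here [n] is tested instead of [m], since beyond [z] the primes [q i] can contribute to a square;
    in particular every diagonal pair is [large]. *)
Let large (ij : I * I) : bool :=
  has (fun d => prime d && (d ^ 2 %| n ij)%N) (iota z.+1 (p * N ^ 2)).

(** Both primes of a pair divide its [n], so at most [w ^ 2] pairs share one [n]. The values of [n]
    are counted by [card_progression_le] for [d <= D], and for [d > D] by [card_sqr_multiples_le]
    over the cofactors [e <= p * N ^ 2 / D ^ 2]. *)
Lemma card_large_square_le :
  (#|[set ij | large ij]| <= w ^ 2 * (N ^ 2 %/ z + D + 2 * (p * N ^ 2 %/ D ^ 2).+1))%N.
Proof.
pose B := (p * N ^ 2)%N.
pose f ij : 'I_B := Ordinal (nlt ij).
have B0 : (B <= p ^ 2)%N by rewrite /B expnS expn1 leq_mul2l NP orbT.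
apply: leq_trans (card_le_fibers (f := f) (b := w ^ 2) _) _.
  move=> y /imsetP[ij0 _ yE].
  have H : (#|[set i | q i %| n ij0]| < w)%N.
    by apply: (card_prime_divisors_lt (z := z)) => //; rewrite n0 (leq_trans (nlt _)).
  rewrite -mulnn; apply: leq_trans (leq_mul (ltnW H) (ltnW H)).
  rewrite -cardsX; apply: subset_leq_card; apply/subsetP => ij.
  rewrite !inE => /andP[_ /eqP]; rewrite yE => /(congr1 val) /= <-.
  by rewrite /n -mulnA dvdn_mulr // mulnCA dvdn_mulr.
rewrite leq_mul2l; apply/orP; right.
pose P2 d := [pred x : 'I_B | (d ^ 2 %| x)%N && (x == a %[mod p])].
pose P3 (e : nat) := [pred x : 'I_B |
  ((x : nat)%:R == a) && [exists d : 'I_p, (x : nat) == (d ^ 2 * e)%N]].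
pose S2 := [set x | has (P2^~ x) [seq d <- iota z.+1 (D - z) | prime d]].
pose E := (B %/ D ^ 2)%N.
pose S3 := [set x | has (P3^~ x) (iota 0 E.+1)].
have sub : f @: [set ij | large ij] \subset S2 :|: S3.
  apply/subsetP => x /imsetP[ij]; rewrite !inE => /hasP[d]; rewrite mem_iota => /andP[zd dB].
  move=> /andP[dp dn] ->; case: (leqP d D) => dD; apply/orP; [left|right]; apply/hasP.
    exists d; first by rewrite mem_filter dp mem_iota; lia.
    rewrite /= dn /=; apply/eqP.
    by rewrite -(val_Fp_nat pp (n ij)) nF modn_small // -[X in (_ < X)%N](Fp_cast pp).
  have [e ne] := dvdnP dn.
  have eE : (e <= E)%N.
    rewrite leq_divRL ?expn_gt0; last by lia.
    by apply: leq_trans (ltnW (nlt ij)); rewrite ne leq_mul2l leq_exp2r // (ltnW dD) orbT.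
  (* Here [d ^ 2 <= n < p * N ^ 2 <= p ^ 2]. *)
  have ltdp : (d < p)%N.
    rewrite -(@ltn_exp2r _ _ 2) //; apply: leq_trans B0; apply: leq_ltn_trans (nlt ij).
    by apply: dvdn_leq.
  exists e; first by rewrite mem_iota /= add0n ltnS.
  rewrite /= nF eqxx /=; apply/existsP; exists (Ordinal ltdp).
  by rewrite /= ne mulnC.
apply: leq_trans (subset_leq_card sub) _; apply: leq_trans (leq_card_setU _ _) _.
apply: leq_add; last first.
  apply: leq_trans (card_has_le _ _) _.
  apply: leq_trans (_ : \sum_(e <- iota 0 E.+1) 2 <= _)%N.
    by apply: leq_sum => e _; apply: card_sqr_multiples_le.
  by rewrite big_const_seq count_predT size_iota iter_addn_0.
apply: leq_trans (card_has_le _ _) _; rewrite big_filter.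
apply: leq_trans (_ : \sum_(d <- iota z.+1 (D - z)) (N ^ 2 %/ d ^ 2).+1 <= _)%N.
  rewrite big_mkcond /= big_seq [leqRHS]big_seq; apply: leq_sum => d.
  rewrite mem_iota => /andP[zd dD]; case: ifP => // dp.
  have d0 : (0 < d ^ 2)%N by rewrite expn_gt0 prime_gt0.
  have cp : coprime p (d ^ 2).
    by rewrite coprimeXr // prime_coprime // dvdn_prime2 // neq_ltn; apply/orP; right; lia.
  apply: leq_trans (card_progression_le a B d0 cp) _.
  by rewrite /B divnMl // prime_gt0.
have -> : (\sum_(d <- iota z.+1 (D - z)) (N ^ 2 %/ d ^ 2).+1 =
    \sum_(z.+1 <= d < D.+1) N ^ 2 %/ d ^ 2 + (D - z))%N.
  under eq_bigr do rewrite -addn1.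
  by rewrite big_split /= /index_iota subSS big_const_seq count_predT size_iota iter_addn_0 mul1n.
apply: leq_add; last exact: leq_subr.
have z0 : (0 < z)%N by exact: ltnW.
rewrite leq_divRL // -(ler_nat rat) natrM natr_sum.
have zr : 0 < z%:R :> rat by rewrite ltr0n.
rewrite -ler_pdivlMr //.
apply: le_trans (_ : (N ^ 2)%:R * \sum_(z.+1 <= d < D.+1) (d%:R ^+ 2)^-1 <= _).
  rewrite mulr_sumr big_nat [leRHS]big_nat; apply: ler_sum => d /andP[zd _].
  have d0 : (0 < d)%N by lia.
  by rewrite ler_pdivlMr ?exprn_gt0 ?ltr0n // -natrX -natrM ler_nat leq_trunc_div.
rewrite ler_wpM2l //; apply: le_trans (sum_inv_sqr_le _ z0 zD) _.
by rewrite gerBl invr_ge0.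
Qed.

(** At most 7/8 of all pairs are [small] and fewer than 1/8 are [large], so some pair is neither. *)
Lemma exists_squarefree_multiple :
  (4 * (32 * z) ^ 8 * 17 ^ 4 * p <= #|I| ^ 4)%N ->
  (8 * (w ^ 2 * (N ^ 2 %/ z + D + 2 * (p * N ^ 2 %/ D ^ 2).+1)) < #|I| ^ 2)%N ->
  exists k : nat, [/\ (0 < k <= p * N ^ 2)%N, smooth p k, squarefree k & k%:R = a :> 'F_p].
Proof.
move=> Kp Kw.
have K0 : (0 < #|I|)%N by move: Kw; case: #|I| => //; rewrite exp0n.
have small_le := card_small_squares_le rat Kp.
have large_le := card_large_square_le.
have : exists ij, ~~ small ij && ~~ large ij.
  apply/existsP; apply: contraT; rewrite negb_exists => /forallP all_bad.
  have : (#|[set: I * I]| <= #|[set ij | small ij]| + #|[set ij | large ij]|)%N.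
    apply: leq_trans (leq_card_setU _ _); apply: subset_leq_card; apply/subsetP => ij _.
    by have := all_bad ij; rewrite !inE negb_and !negbK.
  rewrite cardsT card_prod mulnn -(ler_nat rat) natrD.
  have : (8 * #|[set ij | large ij]|)%:R < (#|I| ^ 2)%:R :> rat.
    by rewrite ltr_nat; apply: leq_ltn_trans Kw; rewrite leq_mul2l large_le.
  rewrite natrM; lra.
case=> ij /andP[nsmall nlarge]; exists (n ij); split; last exact: nF.
- by rewrite n0 ltnW ?nlt.
- move=> d dp; rewrite !Euclid_dvdM // !(dvdn_prime2 dp (qp _)).
  move=> /orP[/orP[/eqP->|/eqP->]|/(dvdn_leq (m0 _)) dm]; try exact: ltnW (qlt _).
  exact: leq_trans dm (ltnW (mlt _)).
(* A prime [d <= z] is coprime to both [q i], so [d ^ 2] would divide [m] and the pair would be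
   [small]; otherwise it would be [large]. *)
move=> d dp; apply/negP => dn; case: (leqP d z) => dz.
  move/hasPn: nsmall => /(_ d); rewrite mem_index_iota prime_gt1 // ltnS dz => /(_ isT)/negP; apply.
  have cop i : coprime (d ^ 2) (q i).
    by rewrite coprimeXl // prime_coprime // dvdn_prime2 // neq_ltn (leq_ltn_trans dz (zq i)).
  by move: dn; rewrite /n !Gauss_dvdr // coprimeMr !cop.
have dlt : (d < p * N ^ 2)%N.
  apply: leq_ltn_trans (nlt ij); apply: leq_trans (dvdn_leq (n0 _) dn).
  by rewrite -{1}(expn1 d) leq_pexp2l // prime_gt0.
move/hasPn: nlarge => /(_ d); rewrite dp dn mem_iota dz ltn_addl //.
by move=> /(_ isT).
Qed.
End GoodPair.

(** * A lower bound for the number of primes *)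

Lemma expn2_le_central_bin n : (2 ^ n <= 'C(n.*2, n))%N.
Proof.
elim: n => // n IH.
have e : ('C(n.+1.*2, n.+1) = 2 * 'C(n.*2.+1, n))%N.
  apply/eqP; rewrite -(eqn_pmul2l (ltn0Sn n)) -mul_bin_diag doubleS; apply/eqP.
  by rewrite /= -mul2n; ring.
rewrite e expnS leq_mul2l /=; apply: leq_trans IH _.
by case: n {e} => // n; rewrite binS leq_addr.
Qed.

(** By Legendre's formula the exponent is the sum over [k] of the floor of [2 * n / q ^ k] minus
    twice that of [n / q ^ k]. Each term is 0 or 1, and it vanishes once [q ^ k > 2 * n]. *)
Lemma logn_central_bin q n : prime q -> (logn q 'C(n.*2, n) <= trunc_log q n.*2)%N.
Proof.
move=> qp; have q1 := prime_gt1 qp.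
have := bin_fact (leq_addl n n); rewrite addnn -[(n.*2 - n)%N]/(_) -addnn addnK addnn.
move=> /(congr1 (logn q)); rewrite !lognM ?muln_gt0 ?fact_gt0 ?bin_gt0 -?addnn ?leq_addr //.
rewrite addnn !logn_fact //.
have ext : (\sum_(1 <= k < n.+1) n %/ q ^ k = \sum_(1 <= k < n.*2.+1) n %/ q ^ k)%N.
  rewrite [RHS](@big_cat_nat _ _ _ n.+1) //=; last by rewrite ltnS -addnn leq_addr.
  rewrite [X in (_ = _ + X)%N]big_nat [X in (_ = _ + X)%N]big1 ?addn0 // => k /andP[nk _].
  by rewrite divn_small // (leq_ltn_trans _ (ltn_expl k q1)) // ltnW.
rewrite ext => e.
rewrite -(leq_add2r (\sum_(1 <= k < n.*2.+1) n %/ q ^ k +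
  \sum_(1 <= k < n.*2.+1) n %/ q ^ k)).
rewrite e -big_split /=.
set T := trunc_log q n.*2.
have [->//|n0] := posnP n; first by rewrite big_geq.
have T2 : (T <= n.*2)%N.
  by apply: leq_trans (trunc_logP q1 _); rewrite ?double_gt0 // ltnW // ltn_expl.
have TE : (T = \sum_(1 <= k < n.*2.+1) (k <= T))%N.
  rewrite (@big_cat_nat _ _ _ T.+1) //=.
  rewrite [X in (_ + X)%N]big_nat [X in (_ + X)%N]big1 ?addn0; last first.
    by move=> k /andP[Tk _]; rewrite leqNgt Tk.
  rewrite big_nat (eq_bigr (fun=> 1%N)); last by move=> k /andP[_]; rewrite ltnS => ->.
  by rewrite -big_nat sum_nat_const_nat subSS subn0 muln1.
rewrite [X in (_ <= X + _)%N]TE -big_split /= big_nat [leqRHS]big_nat.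
apply: leq_sum => k /andP[k1 _].
have qk : (0 < q ^ k)%N by rewrite expn_gt0 prime_gt0.
case: (leqP k T) => kT.
  by have := divnD n n qk; rewrite addnn => ->; rewrite addnC leq_add2r; case: (q ^ k <= _)%N.
rewrite divn_small // ltnNge; apply/negP => h.
by have := trunc_log_max q1 h; rewrite -/T leqNgt kT.
Qed.

Lemma prime_dvdn_fact q n : prime q -> (q %| n`!)%N -> (q <= n)%N.
Proof.
move=> qp; elim: n => [|n IH]; first by rewrite fact0 dvdn1 => /eqP q1; move: qp; rewrite q1.
by rewrite factS Euclid_dvdM // => /orP[/dvdn_leq->//|/IH/leqW].
Qed.

(** Chebyshev's argument: each prime power in the central binomial coefficient is at most
    [2 * n < 2 ^ l], while the coefficient is at least [2 ^ n]. *)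
Lemma leq_count_primes n l : (n.*2 < 2 ^ l)%N ->
  (n <= l * size [seq q <- iota 1 n.*2 | prime q])%N.
Proof.
move=> nl; have [->//|n0] := posnP n.
set s := filter _ _; rewrite -(@leq_exp2l 2) // expnM.
apply: leq_trans (expn2_le_central_bin n) _.
have C0 : (0 < 'C(n.*2, n))%N by rewrite bin_gt0 -addnn leq_addr.
rewrite [leqLHS](prod_prime_decomp C0) prime_decompE big_map /=.
have sub : {subset primes 'C(n.*2, n) <= s}.
  move=> q; rewrite mem_primes => /and3P[qp _ qC]; rewrite mem_filter qp mem_iota prime_gt0 //=.
  have : (q %| n.*2`!)%N.
    by rewrite -(@bin_fact n.*2 n) ?dvdn_mulr // -addnn leq_addr.
  by rewrite add1n ltnS; apply: prime_dvdn_fact.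
apply: leq_trans (_ : \prod_(q <- primes 'C(n.*2, n)) 2 ^ l <= _)%N.
  rewrite big_seq [leqRHS]big_seq; apply: leq_prod => q; rewrite mem_primes => /and3P[qp _ _].
  apply: ltnW (leq_ltn_trans _ nl).
  apply: leq_trans (trunc_logP (prime_gt1 qp) _); rewrite ?double_gt0 //.
  by rewrite leq_exp2l ?prime_gt1 // logn_central_bin.
rewrite big_const_seq count_predT iter_muln_1 leq_exp2l; last first.
  by rewrite (leq_ltn_trans _ nl) // double_gt0.
by apply: uniq_leq_size sub; apply: primes_uniq.
Qed.

(** Used with [t] the bit length of [z], to make [z] exceed a constant times the square of its
    logarithm. *)
Lemma exists_squares_le_exp c : exists T, forall t, (T <= t)%N -> (c * t ^ 2 <= 2 ^ t)%N.
Proof.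
exists (64 * c + 4)%N => t tc.
pose s := (t %/ 4)%N.
have [ts st] : (t < 4 * s.+1)%N /\ (4 * s <= t)%N by rewrite /s; split; lia.
have s2 : (s.+1 <= 2 ^ s)%N by rewrite ltn_expl.
have cs : (16 * c <= 2 ^ (s + s))%N.
  by apply: leq_trans (ltnW (ltn_expl _ (isT : 1 < 2)%N)); lia.
apply: leq_trans (_ : 2 ^ (4 * s) <= _)%N; last by rewrite leq_exp2l.
have -> : (4 * s = (s + s) + (s + s))%N by lia.
rewrite expnD; apply: leq_trans (leq_mul cs (leqnn _)).
have t4 : (t <= 4 * 2 ^ s)%N by lia.
have -> : (16 * c * 2 ^ (s + s) = c * (4 * 2 ^ s) ^ 2)%N.
  by rewrite expnD; move: (2 ^ s)%N => x; ring.
by rewrite leq_mul2l leq_exp2r // t4 orbT.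
Qed.

Lemma squarefree_prime p : prime p -> squarefree p.
Proof.
move=> pp d dp; apply/negP => dd.
have : (d %| p)%N by apply: dvdn_trans dd; rewrite expnS dvdn_mulr.
rewrite dvdn_prime2 // => /eqP dE; subst d.
have := dvdn_leq (prime_gt0 pp) dd; rewrite leqNgt => /negP; apply.
by rewrite -{1}(expn1 p) ltn_exp2l // prime_gt1.
Qed.

Lemma smooth_self p : (0 < p)%N -> smooth p p.
Proof. by move=> p0 d _; apply: dvdn_leq. Qed.

(** Discarding the primes up to [z] loses at most [z], and [l * z <= N / 8]; the factor 4 in place
    of 2 absorbs this and the rounding of [N./2]. *)
Lemma leq_count_primes_interval N z l :
  (N < 2 ^ l)%N -> (8 * l * z <= N)%N -> (2 <= N)%N -> (z <= N)%N ->
  (N <= 4 * l * size [seq q <- iota z.+1 (N - z) | prime q])%N.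
Proof.
move=> Nl lz N2 zN; set K := size _.
have h := @leq_count_primes N./2 l; set s := size _ in h.
have Nh : (N <= N./2.*2.+1 /\ N./2.*2 <= N)%N by have := odd_double_half N; lia.
have sK : (s <= K + z)%N.
  rewrite /s /K !size_filter.
  apply: leq_trans (_ : count prime (iota 1 N) <= _)%N.
    have e : N = (N./2.*2 + (N - N./2.*2))%N by lia.
    by rewrite {2}e iotaD count_cat leq_addr.
  rewrite -{1}(subnKC zN) iotaD count_cat addnC add1n leq_add2l.
  by apply: leq_trans (count_size _ _) _; rewrite size_iota.
have {}h : (N./2 <= l * s)%N by apply: h; lia.
nia.
Qed.


(** * Choice of parameters *)

(* The primes in [(z, z ^ (k + 3)]] number at least [z ^ (k + 3) / (4 * l)]; the
   two bounds on [z] absorb [(4 * l) ^ 2] into the count of large square factors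
   and [(4 * l) ^ 4] into the discrepancy condition, respectively. As the primes
   exceed [z], at most [6 * k + 7] of them divide a given [n <= z ^ (6 * k + 7)]. *)
Lemma covers_residues_le k z l p : prime p -> (10 <= k)%N ->
  (z ^ (4 * k) <= p <= z ^ (4 * k).+1)%N -> (z ^ (k + 3) < 2 ^ l)%N ->
  (768 * (6 * k + 7) ^ 2 * l ^ 2 < z)%N -> (4 * 32 ^ 8 * 17 ^ 4 * 4 ^ 4 <= z)%N ->
  covers_residues p (p * (z ^ (k + 3)) ^ 2).
Proof.
move=> pp k10 /andP[zp pz] Nl lz; move E : (4 * 32 ^ 8 * 17 ^ 4 * 4 ^ 4)%N => A Az.
(* [D] lies just above the square root of [p], so that both [D] and [p * N ^ 2 / D ^ 2] are at most
   [N ^ 2 / z]. *)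
set N := (z ^ (k + 3))%N; set D := (z ^ (2 * k).+1)%N; set w := (6 * k + 7)%N.
have l0 : (0 < l)%N.
  by rewrite lt0n; apply/negP => /eqP l0; move: Nl; rewrite l0 expn0 ltnS leqn0 expn_eq0; lia.
have z32 : (32 * l <= z)%N.
  apply: leq_trans (ltnW lz); rewrite -/w.
  have w1 : (1 <= w ^ 2)%N by rewrite expn_gt0 /w addnS.
  have ll : (l <= l ^ 2)%N by rewrite expnS expn1 leq_pmulr.
  by apply: leq_mul ll; apply: (@leq_trans (768 * 1)); rewrite ?leq_mul2l ?w1 ?orbT.
have z32' : (32 <= z)%N by apply: leq_trans z32; rewrite leq_pmulr.
have z1 : (1 < z)%N by lia.
have pE i j : (i <= j)%N -> (z ^ i <= z ^ j)%N by move=> ij; rewrite leq_pexp2l //; lia.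
have zN : (z <= N)%N by rewrite -{1}(expn1 z) pE; lia.
have NN : (N ^ 2 = z ^ (2 * k + 6))%N by rewrite /N -expnM; congr expn; lia.
pose s := [seq q <- iota z.+1 (N - z) | prime q].
have sN : (N <= 4 * l * size s)%N.
  apply: leq_count_primes_interval => //; last by lia.
  apply: leq_trans (_ : z ^ 2 <= _)%N; last by apply: pE; lia.
  by rewrite expnS expn1 leq_mul2r; lia.
pose q (i : 'I_(size s)) : nat := nth 0%N s i.
have qs i : q i \in s by rewrite mem_nth.
have qinj : injective q.
  move=> i j /eqP; rewrite nth_uniq ?filter_uniq ?iota_uniq //.
  by move/eqP/val_inj.
have qp i : prime (q i) by move: (qs i); rewrite mem_filter => /andP[].
have qzN i : (z < q i <= N)%N by move: (qs i); rewrite mem_filter mem_iota; lia.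
(* [2 * N ^ 3 < z ^ (3 * k + 10)], which is at most [z ^ (4 * k)] because [k >= 10]. *)
have Np : (2 * N ^ 3 < p)%N.
  apply: leq_trans zp; apply: leq_trans (_ : z * N ^ 3 <= _)%N.
    by rewrite ltn_pmul2r ?expn_gt0; lia.
  by rewrite /N -expnM -expnS pE //; lia.
have Dp : (D < p)%N by apply: leq_trans zp; rewrite ltn_exp2l //; lia.
have zD : (z <= D)%N by rewrite -{1}(expn1 z) pE.
have zzp : (8 * z ^ 2 <= p)%N.
  apply: leq_trans zp; apply: leq_trans (_ : z * z ^ 2 <= _)%N.
    by rewrite leq_mul2r; lia.
  by rewrite -expnS pE //; lia.
have zw : (p * N ^ 2 <= z ^ w)%N.
  rewrite NN; apply: leq_trans (leq_mul pz (leqnn _)) _.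
  by rewrite -expnD pE // /w; lia.
(* The exponents add up to 1 + 2 + 8 + (4 * k + 1) = 4 * (k + 3); this is the origin of the exponent
   [k + 3] in [N]. *)
have Kp : (4 * (32 * z) ^ 8 * 17 ^ 4 * p <= #|'I_(size s)| ^ 4)%N.
  rewrite card_ord -(@leq_pmul2l ((4 * l) ^ 4)) ?expn_gt0 ?muln_gt0 ?l0 // -expnMn.
  have : (N ^ 4 <= (4 * l * size s) ^ 4)%N by rewrite leq_exp2r.
  apply: leq_trans; rewrite !expnMn.
  have -> : (4 ^ 4 * l ^ 4 * (4 * (32 ^ 8 * z ^ 8) * 17 ^ 4 * p) = A * (l ^ 4) * (z ^ 8 * p))%N.
    by rewrite -E; move: (32 ^ 8)%N (17 ^ 4)%N (4 ^ 4)%N => x y t; ring.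
  have l4 : (l ^ 4 <= z ^ 2)%N.
    rewrite (expnM l 2 2) leq_exp2r //; apply: leq_trans (ltnW lz).
    by rewrite leq_pmull // muln_gt0 expn_gt0 -/w /w addnS.
  apply: leq_trans (leq_mul (leq_mul Az l4) (leq_mul (leqnn _) pz)) _.
  by rewrite /N -expnS -!expnD -expnM pE //; lia.
(* The three terms total at most [6 * Y] with [Y = N ^ 2 / z]; with the factors 8 and [(4 * l) ^ 2]
   this gives the constant 768 = 16 * 8 * 6. *)
have Kw : (8 * (w ^ 2 * (N ^ 2 %/ z + D + 2 * (p * N ^ 2 %/ D ^ 2).+1)) < #|'I_(size s)| ^ 2)%N.
  rewrite card_ord -(@ltn_pmul2l ((4 * l) ^ 2)) ?expn_gt0 ?muln_gt0 ?l0 // -expnMn.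
  have : (N ^ 2 <= (4 * l * size s) ^ 2)%N by rewrite leq_exp2r.
  apply: leq_trans; rewrite NN.
  have Y0 : (0 < z ^ (2 * k + 5))%N by rewrite expn_gt0; lia.
  have h1 : (z ^ (2 * k + 6) %/ z = z ^ (2 * k + 5))%N.
    by rewrite addnS expnS mulKn //; lia.
  have h2 : (D <= z ^ (2 * k + 5))%N by apply: pE; lia.
  have h3 : (p * z ^ (2 * k + 6) %/ D ^ 2 <= z ^ (2 * k + 5))%N.
    have D0 : (0 < D ^ 2)%N by rewrite !expn_gt0; lia.
    rewrite -[leqRHS](mulnK _ D0); apply: leq_div2r.
    apply: leq_trans (leq_mul pz (leqnn _)) _.
    by rewrite /D -expnM -!expnD pE //; lia.
  rewrite h1; set Y := (z ^ (2 * k + 5))%N in Y0 h1 h2 h3 *.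
  have h4 : (Y + D + 2 * (p * z ^ (2 * k + 6) %/ D ^ 2).+1 <= 6 * Y)%N.
    by move: (_ %/ D ^ 2)%N h3 Y0 h2 => X; clear; lia.
  apply: leq_ltn_trans (_ : (4 * l) ^ 2 * (8 * (w ^ 2 * (6 * Y))) < _)%N.
    by rewrite !leq_mul2l h4 !orbT.
  have -> : ((4 * l) ^ 2 * (8 * (w ^ 2 * (6 * Y))) = 768 * w ^ 2 * l ^ 2 * Y)%N by ring.
  have -> : (z ^ (2 * k + 6) = z * Y)%N by rewrite /Y -expnS; congr expn; lia.
  by rewrite ltn_pmul2r.
(* The class of 0 is represented by [p] itself. *)
move=> b; have [b0|b0] := eqVneq (b%:R : 'F_p) 0.
  exists p; split; [|exact: smooth_self (prime_gt0 pp)|exact: squarefree_prime|].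
    by rewrite prime_gt0 // leq_pmulr // expn_gt0 (leq_trans (ltnW z1) zN).
  have := congr1 val b0; rewrite /= val_Fp_nat // => ->; rewrite modnn //.
have [m [m1 m2 m3 m4]] := exists_squarefree_multiple pp qinj qp
  (fun i => proj2 (andP (qzN i))) (fun i => proj1 (andP (qzN i))) b0 Np z1 zD Dp zzp zw Kp Kw.
by exists m; split=> //; rewrite -!(val_Fp_nat pp) m4.
Qed.

Lemma exists_root_bracket e p : (0 < e)%N -> (0 < p)%N ->
  exists z, (z ^ e <= p < z.+1 ^ e)%N.
Proof.
move=> e0 p0.
have ex : exists z, (z ^ e <= p)%N by exists 0%N; rewrite exp0n.
have bd z : (z ^ e <= p)%N -> (z <= p)%N.
  by apply: leq_trans; case: z => // z; rewrite -{1}(expn1 z.+1) leq_pexp2l.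
case: (ex_maxnP ex bd) => z zp zmax; exists z; rewrite zp ltnNge /=.
by apply/negP => /zmax; rewrite ltnn.
Qed.

(** Take for [z] the integer part of the [4 * k]-th root of [p]: then [p * z ^ (2 * k + 6)] is at
    most [p] to the power 3/2 + 3/(2k), written here without fractional exponents. *)
Lemma covers_residues_eventually k : (10 <= k)%N ->
  exists P, forall p, prime p -> (P <= p)%N ->
    exists2 M, covers_residues p M & (M ^ (2 * k) <= p ^ (3 * k + 3))%N.
Proof.
move=> k10; pose C := (768 * (6 * k + 7) ^ 2)%N.
(* The factor 2 pays for [2 ^ t <= 2 * z], and the [+ 1] makes the resulting bound on [z] strict. *)
have [T HT] := exists_squares_le_exp (2 * (C * (k + 3) ^ 2 + 1)).
have [A HA] : exists A, (4 * 32 ^ 8 * 17 ^ 4 * 4 ^ 4 <= A)%N.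
  by eexists; exact: leqnn.
(* The summand [16 ^ k] serves [p < (2 * z) ^ (4 * k) <= z ^ (4 * k).+1]; the other two give the
   lower bounds on [z] in [covers_residues_le]. *)
exists ((16 ^ k + 2 ^ T + A) ^ (4 * k))%N => p pp Pp.
have k4 : (0 < 4 * k)%N by lia.
have [z /andP[zp pz]] := exists_root_bracket k4 (prime_gt0 pp).
have zbig : (16 ^ k + 2 ^ T + A <= z)%N.
  by rewrite -ltnS -(ltn_exp2r _ _ k4) (leq_ltn_trans Pp).
have z16 : (16 ^ k <= z)%N by lia.
have zT : (2 ^ T <= z)%N by lia.
have z0 : (0 < z)%N by apply: leq_trans z16; rewrite expn_gt0.
have pz' : (p <= z ^ (4 * k).+1)%N.
  apply: leq_trans (ltnW pz) _; apply: leq_trans (_ : (2 * z) ^ (4 * k) <= _)%N.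
    by rewrite leq_exp2r //; lia.
  by rewrite expnMn expnS leq_mul2r (expnM 2 4 k) z16 orbT.
pose t := (trunc_log 2 z).+1.
have zt : (z < 2 ^ t)%N by exact: trunc_log_ltn.
have tz : (2 ^ t <= 2 * z)%N by rewrite expnS leq_mul2l trunc_logP.
have tT : (T <= t)%N by rewrite -(@leq_exp2l 2) // ltnW // (leq_ltn_trans zT).
have t0 : (0 < t ^ 2)%N by rewrite expn_gt0.
exists (p * (z ^ (k + 3)) ^ 2)%N.
  apply: (covers_residues_le (l := t * (k + 3))) => //; [by rewrite zp pz'| | |].
  - by rewrite expnM ltn_exp2r // addnS.
  - have := HT t tT; rewrite -/C (expnMn t); move: (t ^ 2)%N ((k + 3) ^ 2)%N t0 => x y x0 h.
    by have := leq_trans h tz; rewrite -mulnA leq_mul2l /=; nia.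
  - by apply: leq_trans HA _; lia.
rewrite expnMn -!expnM.
have -> : (p ^ (3 * k + 3) = p ^ (2 * k) * p ^ (k + 3))%N by rewrite -expnD; congr expn; lia.
rewrite leq_mul2l; apply/orP; right.
have -> : ((k + 3) * (2 * (2 * k)) = 4 * k * (k + 3))%N by lia.
by rewrite expnM leq_exp2r // addnS.
Qed.

(* From covered residues to the exponent of M(p) *)
From mathcomp Require Import all_classical all_reals all_analysis.
Import numFieldNormedType.Exports.
Local Open Scope classical_set_scope.

Lemma Msf_covers (R : realType) (p N : nat) : covers_residues p N ->
  exists m : nat, [/\ Msf R p = m%:R%:E, (0 < m)%N & (m <= N)%N].
Proof.
move=> cN; rewrite /Msf; case: pselect => [h|[]]; last by exists N.
case: ex_minnP => m /asboolP cm mmin; exists m; split => //; last exact/mmin/asboolP.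
by have [n [/andP[n0 nm] _ _ _]] := cm 0%N; apply: leq_trans nm.
Qed.

(** Measuring the actual exponent gives one function for all [k], although the threshold in
    [covers_residues_eventually] depends on [k]. On an infinite value [fine] returns 0. *)
Definition excess (R : realType) (p : nat) : R :=
  Num.max 0 (ln (fine (Msf R p)) / ln p%:R - 3 / 2).

Lemma Msf_le_excess (R : realType) (p N : nat) : (1 < p)%N -> covers_residues p N ->
  (Msf R p <= (p%:R `^ (3 / 2 + excess R p))%:E)%E.
Proof.
move=> p1 /(Msf_covers R)[m [E m0 _]].
have lnp : 0 < ln p%:R :> R by rewrite ln_gt0 // ltr1n.
have pR : 0 < p%:R :> R by rewrite ltr0n; lia.
rewrite E lee_fin /powR gt_eqF // -[leLHS]lnK ?posrE ?ltr0n // ler_expR.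
rewrite -ler_pdivrMr // /excess E /= -lerBlDl.
by rewrite le_max lexx orbT.
Qed.

Lemma excess_le (R : realType) (p N k : nat) : (1 < p)%N -> (0 < k)%N -> covers_residues p N ->
  (N ^ (2 * k) <= p ^ (3 * k + 3))%N -> 0 <= excess R p <= 3 / (2 * k%:R).
Proof.
move=> p1 k0 /(Msf_covers R)[m [E m0 mN]] Np.
have kR : 0 < k%:R :> R by rewrite ltr0n.
rewrite /excess le_max lexx /= ge_max divr_ge0 ?mulr_ge0 //= E /=.
have lnp : 0 < ln p%:R :> R by rewrite ln_gt0 // ltr1n.
rewrite lerBlDr ler_pdivrMr //.
have : ln ((m ^ (2 * k))%:R : R) <= ln ((p ^ (3 * k + 3))%:R : R).
  rewrite ler_ln ?posrE ?ltr0n ?expn_gt0 ?m0 //; last by rewrite (ltnW p1).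
  by rewrite ler_nat; apply: leq_trans Np; rewrite leq_exp2r // muln_gt0.
rewrite !natrX !lnXn ?ltr0n //; last exact: ltnW p1.
rewrite -[leLHS]mulr_natr -[leRHS]mulr_natr natrM natrD natrM => h.
have -> : 3 / (2 * k%:R) + 3 / 2 = (3 * k%:R + 3) / (2 * k%:R) :> R.
  by field; rewrite gt_eqF.
rewrite mulrAC ler_pdivlMr ?mulr_gt0 //; lra.
Qed.

Theorem theorem1p4 (R : realType) :
  exists eps : nat -> R,
    eps p @[p --> within [set p | prime p] \oo] --> (0 : R) /\
    \forall p \near within [set p | prime p] \oo,
      (Msf R p <= (p%:R `^ (3 / 2 + eps p))%:E)%E.
Proof.
exists (excess R); split.
  apply/cvgrPdist_le => e e0.
  (* Large enough that [3 / (2 * k) <= e]. *)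
  pose k := (maxn 10 (Num.trunc (3 / 2 / e)).+1).
  have k10 : (10 <= k)%N by exact: leq_maxl.
  have [P HP] := covers_residues_eventually k10.
  exists P => // p /= Pp pp.
  have [N cN Np] := HP p pp Pp.
  have k0 : (0 < k)%N by lia.
  have /andP[h1 h2] := excess_le R (prime_gt1 pp) k0 cN Np.
  rewrite sub0r normrN ger0_norm //; apply: le_trans h2 _.
  have kR : 0 < k%:R :> R by rewrite ltr0n.
  rewrite invfM mulrA ler_pdivrMr // [e * _]mulrC -ler_pdivrMr //.
  apply: le_trans (ltW (truncnS_gt _)) _.
  by rewrite ler_nat leq_maxr.
(* Any fixed [k] serves here: the bound with [excess] only asks that M(p) be finite. *)
have [P HP] := covers_residues_eventually (leqnn 10).
exists P => // p /= Pp pp.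
have [N cN _] := HP p pp Pp.
exact: Msf_le_excess (prime_gt1 pp) cN.
Qed.
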